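(* There exist a $0$-dimensional Polish space $\mathbb{X}_3$ and an analytic relation $\mathbb{A}_3\subseteq\mathbb{X}_3\times\mathbb{X}_3$ such that for every Polish space $X$ and every analytic relation $A\subseteq X\times X$, exactly one of the following holds: (a) there is a map $c:X\to\omega$ such that $c^{-1}(\{n\})\in\mathbf{\Delta}^0_3(X)$ for every $n\in\omega$ and $c(x)\neq c(y)$ whenever $(x,y)\in A$; (b) there is a continuous map $f:\mathbb{X}_3\to X$ such that $(f(\alpha),f(\beta))\in A$ for every $(\alpha,\beta)\in\mathbb{A}_3$.
   Context: $\mathbf{\Delta}^0_3$ denotes the boldface Borel class of sets that are both $\mathbf{\Sigma}^0_3$ and $\mathbf{\Pi}^0_3$. A relation on $X$ is a subset of $X\times X$. *)

(* Defs.v *)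
From HB Require Import structures.
From mathcomp Require Import all_boot all_order all_algebra.
From mathcomp Require Import all_classical all_reals all_analysis.
From mathcomp Require Import Rstruct Rstruct_topology.
Set Implicit Arguments. Unset Strict Implicit. Unset Printing Implicit Defensive.
Import Order.TTheory GRing.Theory Num.Theory.
Import numFieldNormedType.Exports.
Local Open Scope classical_set_scope.
Local Open Scope ring_scope.

Section Defs.
Context {T : topologicalType}.

Definition is_metric (d : T -> T -> Rdefinitions.R) :=
  [/\ forall x y, d x y = 0 <-> x = y,
      forall x y, d x y = d y x &
      forall x y z, d x z <= d x y + d y z].

Definition metric_compatible (d : T -> T -> Rdefinitions.R) :=
  forall U : set T, open U <->
    (forall x, U x -> exists2 e : Rdefinitions.R, 0 < e & [set y | d x y < e] `<=` U).

Definition metric_complete (d : T -> T -> Rdefinitions.R) :=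
  forall u : nat -> T,
    (forall e : Rdefinitions.R, 0 < e ->
       exists N : nat, forall m n, (N <= m)%N -> (N <= n)%N -> d (u m) (u n) < e) ->
    exists x : T, u @ \oo --> x.

Definition separable_space := exists D : set T, countable D /\ closure D = setT.

Definition polish :=
  separable_space /\
  exists d, [/\ is_metric d, metric_compatible d & metric_complete d].

Definition zero_dim :=
  forall (x : T) (U : set T), open U -> U x ->
    exists V : set T, [/\ clopen V, V x & V `<=` U].

(* boldface additive Borel classes: Sigma0_ n is Sigma^0_(n+1);
   Sigma^0_1 = open sets, Sigma^0_(n+1) = countable unions of Pi^0_n sets,
   Pi^0_n = complements of Sigma^0_n sets. *)
Fixpoint Sigma0_ (n : nat) : set (set T) :=
  match n with
  | 0 => open
  | k.+1 => [set S | exists F : (set T)^nat,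
                      (forall i, Sigma0_ k (~` F i)) /\ S = \bigcup_i F i]
  end.

Definition Sigma0 (n : nat) (S : set T) := Sigma0_ n.-1 S.
Definition Pi0 (n : nat) (S : set T) := Sigma0 n (~` S).
Definition Delta0 (n : nat) (S : set T) := Sigma0 n S /\ Pi0 n S.

End Defs.
Arguments polish : clear implicits.
Arguments zero_dim : clear implicits.

(* analytic subset of a topological space Y: a continuous image of a
   Polish space (the empty set is the image of the empty Polish space) *)
Definition analytic {Y : topologicalType} (S : set Y) :=
  exists (P : topologicalType) (g : P -> Y),
    [/\ polish P, continuous g & g @` setT = S].

(* Main.v *)
(** (a) says that X is a countable union of A-independent G_delta sets; call a
subset of X small if it is covered by countably many such sets. Let A be the
image of a Polish space P under (e_0, e_1). The key fact is: if V is not small,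
some nonempty E in P is such that V /\ cl(e_i(O /\ E)) is not small for every
open O meeting E and i = 0, 1. Otherwise countably many closed sets F_n with
V /\ F_n small would meet every edge, and the complement of their union would be
an independent G_delta set containing the rest of V.

If X is not small, iterating this fact along a countable system of nodes gives
sets V_n, E_n: a node C n i restarts from V_n /\ cl(e_i(E_n)), while D n i m j
shrinks E_n around an edge whose i-th endpoint is close to a point e_j(p_m)
already known to be in cl(e_i(E_n)). The space X_3 consists of the infinite
branches of the resulting tree of positions (n, i), and an edge of A_3 is the
pair of branches following the two endpoints along a sequence of successive
D-steps. The points attached to the positions converge along branches, which
yields the homomorphism.

Conversely, let X_3 be covered by independent G_delta sets, the k-th one being the
complement of the union of closed sets F_{k,m}. Below every position there is
then a position q such that some F_{k,m} meets the neighbourhood of every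
position below q: if not, D-steps could steer both endpoints of an edge out of
all F_{k,m}. Descending for k = 0, 1, 2 and so on gives an uncovered point. *)
Require Import Defs.
From HB Require Import structures.
From mathcomp Require Import all_boot all_order all_algebra.
From mathcomp Require Import all_classical all_reals all_analysis.
From mathcomp Require Import Rstruct lra.
Set Implicit Arguments.
Unset Strict Implicit.
Unset Printing Implicit Defensive.
Import Order.TTheory GRing.Theory Num.Theory.
Local Open Scope classical_set_scope.

Local Notation R := Rdefinitions.R.

(** * Borel classes and metrics *)

Section Hierarchy.
Context {T : topologicalType}.
Implicit Types (F : (set T)^nat) (S : set T).

Lemma Sigma0_bigcup n F :
  (forall i, Sigma0_ n (F i)) -> Sigma0_ n (\bigcup_i F i).
Proof.
case: n => [|n] /= hF; first exact: bigcup_open.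
have [G hG] := choice hF.
pose p k : nat * nat := odflt (0, 0) (unpickle k).
exists (fun k => G (p k).1 (p k).2); split=> [i|]; first by case: (hG (p i).1).
apply/seteqP; split=> x [i _].
  rewrite (hG i).2 => -[j _ Gx]; exists (pickle (i, j)) => //.
  by rewrite /p pickleK.
by move=> Gx; exists (p i).1 => //; rewrite (hG _).2; exists (p i).2.
Qed.

Lemma Sigma0_setT_set0 n : Sigma0_ n [set: T] /\ Sigma0_ n (set0 : set T).
Proof.
elim: n => [|n [ihT ih0]] /=; first by split; [exact: openT | exact: open0].
split; [exists (fun=> setT) | exists (fun=> set0)]; split.
- by rewrite setCT.
- by apply/seteqP; split=> // x _; exists 0.
- by rewrite setC0.
- by rewrite bigcup0.
Qed.

Lemma Sigma0_setU n S1 S2 :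
  Sigma0_ n S1 -> Sigma0_ n S2 -> Sigma0_ n (S1 `|` S2).
Proof.
move=> h1 h2; rewrite -bigcup2E; apply: Sigma0_bigcup => -[|[|i]] //=.
exact: (Sigma0_setT_set0 n).2.
Qed.

Lemma Sigma0_setI n S1 S2 :
  Sigma0_ n S1 -> Sigma0_ n S2 -> Sigma0_ n (S1 `&` S2).
Proof.
case: n => [|n] /=; first exact: openI.
move=> [F [hF ->]] [G [hG ->]].
rewrite setI_bigcupl; apply: (@Sigma0_bigcup n.+1) => i.
rewrite setI_bigcupr; apply: (@Sigma0_bigcup n.+1) => j /=.
exists (fun=> F i `&` G j); split.
  by move=> _; rewrite setCI; exact: Sigma0_setU.
by apply/seteqP; split=> [x|x [_ _]]; first exists 0.
Qed.

Lemma Sigma0_setC n S : Sigma0_ n S -> Sigma0_ n.+1 (~` S).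
Proof.
move=> hS; exists (fun=> ~` S); split; first by move=> _; rewrite setCK.
by apply/seteqP; split=> [x|x [_ _]]; first exists 0.
Qed.

End Hierarchy.

Lemma Sigma0_preimage {T U : topologicalType} (f : T -> U) n (S : set U) :
  continuous f -> Sigma0_ n S -> Sigma0_ n (f @^-1` S).
Proof.
move=> cf; elim: n S => [|n ih] S /=.
  by move/continuousP: cf; apply.
move=> [F [hF ->]]; exists (fun i => f @^-1` F i); split.
  by move=> i; rewrite preimage_setC; exact: ih.
by rewrite preimage_bigcup.
Qed.

(** * Dyadic radii and compatible metrics *)

Section Eps.
Local Open Scope ring_scope.

Definition eps (n : nat) : R := 2^-1 ^+ n.

Lemma eps_gt0 n : 0 < eps n.
Proof. by rewrite exprn_gt0 // invr_gt0. Qed.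

Lemma epsS n : eps n = eps n.+1 + eps n.+1.
Proof. rewrite /eps exprS; lra. Qed.

Lemma eps_le m n : (m <= n)%N -> eps n <= eps m.
Proof. by move=> mn; apply: ler_wiXn2l => //; lra. Qed.

Lemma eps_lt (e : R) : 0 < e -> exists n, eps n < e.
Proof.
move=> e0; exists (Num.bound e^-1).
have h := archi_boundP (ltW (etrans (invr_gt0 e) e0)).
rewrite /eps exprVn invf_plt ?posrE ?exprn_gt0 //.
apply: lt_trans h _; rewrite -natrX ltr_nat; exact: ltn_expl.
Qed.

End Eps.

Section Metric.
Local Open Scope ring_scope.
Context {T : topologicalType} {d : T -> T -> R}.
Context (md : is_metric d) (cd : metric_compatible d).

Lemma dist_xx x : d x x = 0.
Proof. by case: md => + _ _; move=> /(_ x x) [_]; apply. Qed.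

Lemma dist_sym x y : d x y = d y x.
Proof. by case: md. Qed.

Lemma dist_triangle y x z : d x z <= d x y + d y z.
Proof. by case: md. Qed.

Lemma dist_ge0 x y : 0 <= d x y.
Proof.
by have := dist_triangle y x x; rewrite dist_xx (dist_sym y x); lra.
Qed.

Lemma dist_small x y : (forall n, d x y <= eps n) -> x = y.
Proof.
move=> h; case: md => + _ _; move=> /(_ x y) [+ _]; apply.
apply/eqP; rewrite eq_le dist_ge0 andbT leNgt; apply/negP => /eps_lt [n].
by rewrite ltNge h.
Qed.

Lemma open_dist x e : open [set y | d x y < e].
Proof.
apply/cd => y /= xy; exists (e - d x y); first lra.
by move=> z /= yz; have := dist_triangle y x z; lra.
Qed.

Lemma nbhs_distP x (U : set T) :
  nbhs x U <-> exists n, [set y | d x y < eps n] `<=` U.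
Proof.
rewrite nbhsE; split=> [[B [oB Bx] BU]|[n nU]].
  have [e e0 eB] := (cd B).1 oB x Bx; have [n ne] := eps_lt e0.
  by exists n => y /= xy; apply/BU/eB => /=; lra.
exists [set y | d x y < eps n] => //; split; first exact: open_dist.
by rewrite /= dist_xx eps_gt0.
Qed.

Lemma cvg_distP (u : nat -> T) x :
  u @ \oo --> x <->
  forall k, exists N, forall n, (N <= n)%N -> d x (u n) < eps k.
Proof.
split=> [ux k|h U /nbhs_distP [k kU]].
  have /ux [N _ hN] : nbhs x [set y | d x y < eps k].
    by apply/nbhs_distP; exists k.
  by exists N => n Nn; exact: hN.
by have [N hN] := h k; exists N => // n /= Nn; apply/kU/hN.
Qed.

Lemma closure_distP (A : set T) x :
  closure A x <-> forall n, exists2 y, A y & d x y < eps n.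
Proof.
split=> [cA n|h U /nbhs_distP [n nU]].
  by have [|y [Ay yn]] := cA [set y | d x y < eps n];
    [apply/nbhs_distP; exists n | exists y].
by have [y Ay xy] := h n; exists y; split => //; apply: nU.
Qed.

Lemma closure_dist_le (A : set T) x y e :
  (forall z, A z -> d x z <= e) -> closure A y -> d x y <= e.
Proof.
move=> hA /closure_distP cy; rewrite leNgt; apply/negP => xy.
have [|n ne] := @eps_lt (d x y - e); first lra.
have [z Az yz] := cy n; have := hA z Az.
by have := dist_triangle z x y; rewrite (dist_sym z y); lra.
Qed.

(** The points whose ball of radius [eps n] stays inside [U] form a closed set, and these sets
    exhaust [U]. *)
Lemma Sigma0_open (U : set T) : open U -> Sigma0_ 1 U.
Proof.
move=> oU; exists (fun n => [set x | [set y | d x y < eps n] `<=` U]); split.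
  move=> n; apply/cd => x /= /existsNP[y /not_implyP[/= xy Uy]].
  exists (eps n - d x y); first lra.
  move=> z /= xz; apply/existsNP; exists y; apply/not_implyP; split=> //=.
  by have := dist_triangle x z y; rewrite (dist_sym z x); lra.
apply/seteqP; split=> [x Ux|x [n _]]; last by apply; rewrite /= dist_xx eps_gt0.
by have [n nU] := (nbhs_distP x U).1 (open_nbhs_nbhs (conj oU Ux)); exists n.
Qed.

Lemma Sigma0_S n (S : set T) : Sigma0_ n S -> Sigma0_ n.+1 S.
Proof.
elim: n S => [|n ih] S; first exact: (@Sigma0_open S).
by move=> [F [hF ->]]; exists F; split => // i; exact/ih/hF.
Qed.

End Metric.

(** * Spaces of sequences *)

(** A separate name for the function type, so that it can carry the topology of finite prefixes, in
    which [T] is discrete. *)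
Definition seqsp (T : Type) := nat -> T.

Section SeqSpace.
Context {T : Type}.
Implicit Types (x y z : seqsp T) (U : set (seqsp T)).

Definition agree k x y := forall l, (l < k)%N -> x l = y l.

Lemma agree_sym k x y : agree k x y -> agree k y x.
Proof. by move=> h l /h. Qed.

Lemma agree_trans k y x z : agree k x y -> agree k y z -> agree k x z.
Proof. by move=> h h' l lk; rewrite h ?h'. Qed.

Lemma agree_le j k x y : (j <= k)%N -> agree k x y -> agree j x y.
Proof. by move=> jk h l lj; apply: h; apply: leq_trans jk. Qed.

Definition seqsp_open U := forall x, U x -> exists k, agree k x `<=` U.

Let openT : seqsp_open setT. Proof. by move=> x _; exists 0. Qed.

Let openI U V : seqsp_open U -> seqsp_open V -> seqsp_open (U `&` V).
Proof.
move=> oU oV x [/oU[k kU] /oV[l lV]]; exists (maxn k l) => y xy; split.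
  by apply/kU/(agree_le _ xy); rewrite leq_maxl.
by apply/lV/(agree_le _ xy); rewrite leq_maxr.
Qed.

Let open_bigU (I : Type) (f : I -> set (seqsp T)) :
  (forall i, seqsp_open (f i)) -> seqsp_open (\bigcup_i f i).
Proof.
move=> of_ x [i _ /of_[k kf]]; exists k => y xy; exists i => //; exact: kf.
Qed.

HB.instance Definition _ := gen_eqMixin (seqsp T).
HB.instance Definition _ := gen_choiceMixin (seqsp T).
HB.instance Definition _ :=
  isOpenTopological.Build (seqsp T) openT openI open_bigU.

Lemma seqsp_openP U : open U <-> seqsp_open U.
Proof. by []. Qed.

Lemma open_agree k x : open (agree k x).
Proof. by move=> y xy; exists k => z; exact: agree_trans. Qed.

Lemma seqsp_nbhsP x U : nbhs x U <-> exists k, agree k x `<=` U.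
Proof.
rewrite nbhsE; split=> [[B [oB /oB[k kB]] BU]|[k kU]].
  by exists k; exact: subset_trans BU.
by exists (agree k x) => //; split; [exact: open_agree|].
Qed.

Definition seqsp_dist x y : R :=
  if pselect (exists n, `[< x n <> y n >]) is left h then eps (ex_minn h)
  else 0%R.

Local Open Scope ring_scope.

Variant seqsp_dist_spec x y : R -> Prop :=
| DistEq of x = y : seqsp_dist_spec x y 0
| DistNeq m of x m <> y m & agree m x y : seqsp_dist_spec x y (eps m).

Lemma seqsp_distP x y : seqsp_dist_spec x y (seqsp_dist x y).
Proof.
rewrite /seqsp_dist; case: pselect => [h|h]; last first.
  apply: DistEq; apply/funext => n; apply: contrapT => xy; apply: h.
  by exists n; apply/asboolP.
case: (ex_minnP h) => m /asboolP xym hm; apply: DistNeq => // l.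
rewrite ltnNge => lm; apply: contrapT => /asboolP /hm ml.
by rewrite ml in lm.
Qed.

Lemma seqsp_dist_le k x y : agree k x y -> seqsp_dist x y <= eps k.
Proof.
case: seqsp_distP => [_ _|m xym _ xy]; first exact/ltW/eps_gt0.
by apply: eps_le; rewrite leqNgt; apply/negP => /xy.
Qed.

Lemma agree_dist k x y : seqsp_dist x y < eps k -> agree k.+1 x y.
Proof.
case: seqsp_distP => [-> //|m _ xy mk].
apply: agree_le xy; rewrite ltnNge; apply/negP => km.
by move: mk; rewrite ltNge eps_le.
Qed.

Lemma seqsp_metric : is_metric seqsp_dist.
Proof.
have ge0 u v : 0 <= seqsp_dist u v.
  by case: seqsp_distP => // m _ _; exact/ltW/eps_gt0.
have eq0 u v : seqsp_dist u v = 0 -> u = v.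
  by case: seqsp_distP => // m _ _ m0; have := eps_gt0 m; rewrite m0 ltxx.
have sym u v : seqsp_dist u v <= seqsp_dist v u.
  rewrite leNgt; apply/negP; case: (seqsp_distP u v) => [_|m uvm _].
    by rewrite ltNge ge0.
  by move=> /agree_dist /(_ m (ltnSn m)) /esym.
split=> [x y|x y|x y z].
- split=> [/eq0 //|->].
  by case: seqsp_distP.
- by apply/eqP; rewrite eq_le !sym.
- case: (seqsp_distP x z) => [_|m xz _]; first by rewrite addr_ge0.
  rewrite leNgt; apply/negP => lt.
  have /agree_dist xy : seqsp_dist x y < eps m by have := ge0 y z; lra.
  have /agree_dist yz : seqsp_dist y z < eps m by have := ge0 x y; lra.
  by apply: xz; apply: (agree_trans xy yz).
Qed.

Lemma seqsp_compatible : metric_compatible seqsp_dist.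
Proof.
move=> U; split=> [/seqsp_openP oU x /oU[k kU]|h].
  exists (eps k); first exact: eps_gt0.
  by move=> y /= /agree_dist xy; apply/kU/(agree_le _ xy).
apply/seqsp_openP => x /h[e /eps_lt[n ne] eU].
exists n => y /seqsp_dist_le xy; apply: eU => /=; exact: le_lt_trans ne.
Qed.

Lemma seqsp_complete : metric_complete seqsp_dist.
Proof.
move=> u cu.
have /choice[N hN] k : exists N, forall m n, (N <= m)%N -> (N <= n)%N ->
    agree k.+1 (u m) (u n).
  have [N hN] := cu (eps k) (eps_gt0 k).
  by exists N => m n Nm Nn; apply/agree_dist/hN.
exists (fun l => u (N l) l) => U /seqsp_nbhsP[k kU].
pose M := (\max_(i < k) N i)%N; exists M => // n /= Mn; apply: kU => l lk.
apply: (hN l) => //; apply: leq_trans Mn.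
exact: (leq_bigmax (Ordinal lk)).
Qed.

Lemma seqsp_zero_dim : zero_dim (seqsp T).
Proof.
move=> x U /seqsp_openP oU /oU[k kU]; exists (agree k x); split => //.
split; first exact: open_agree.
rewrite -openC; apply/seqsp_openP => y xy; exists k => z yz xz; apply: xy.
exact/(agree_trans xz)/agree_sym.
Qed.

End SeqSpace.

Lemma seqsp_separable (T : countType) (t0 : T) : separable_space (T := seqsp T).
Proof.
exists (range (fun s : seq T => nth t0 s : seqsp T)); split.
  exact: card_le_trans (card_image_le _ _) (countableP _).
apply/seteqP; split=> // x _ U /seqsp_nbhsP[k kU].
exists (nth t0 (mkseq x k)); split; first by exists (mkseq x k).
by apply: kU => l lk; rewrite nth_mkseq.
Qed.

Lemma seqsp_polish (T : countType) (t0 : T) : polish (seqsp T).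
Proof.
split; first exact: seqsp_separable t0.
exists seqsp_dist; split; [exact: seqsp_metric|exact: seqsp_compatible|].
exact: seqsp_complete.
Qed.

Lemma sequential_choice (S : Type) (I : S -> Prop)
    (Q : nat -> S -> S -> Prop) s0 :
  I s0 -> (forall l s, I s -> exists s', I s' /\ Q l s s') ->
  exists f : nat -> S, f 0 = s0 /\ forall l, I (f l) /\ Q l (f l) (f l.+1).
Proof.
move=> I0 step.
have /choice[g hg] (ls : nat * S) : exists s', I ls.2 -> I s' /\ Q ls.1 ls.2 s'.
  case: (pselect (I ls.2)) => [/(step ls.1)[s' h]|nI]; first by exists s'.
  by exists s0.
pose f := nat_rect (fun=> S) s0 (fun l s => g (l, s)).
have If l : I (f l) by elim: l => //= l /(hg (l, _))[].
by exists f; split => // l; split => //; have [] := hg (l, f l) (If l).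
Qed.

(** * The minimal relation *)

(* A node n stands for a pair (V_n, E_n) as in the header. In [D n i m j] the
   i-th endpoint of the edges is moved close to the position (m, j). *)
Inductive node := Root | C of node & bool | D of node & bool & node & bool.

Fixpoint node_encode n : GenTree.tree bool :=
  match n with
  | Root => GenTree.Node 0 [::]
  | C n i => GenTree.Node 1 [:: GenTree.Leaf i; node_encode n]
  | D n i m j => GenTree.Node 2
      [:: GenTree.Leaf i; GenTree.Leaf j; node_encode n; node_encode m]
  end.

Fixpoint node_decode t : node :=
  match t with
  | GenTree.Node 1 [:: GenTree.Leaf i; n] => C (node_decode n) i
  | GenTree.Node 2 [:: GenTree.Leaf i; GenTree.Leaf j; n; m] =>
      D (node_decode n) i (node_decode m) j
  | _ => Root
  end.

Lemma node_encodeK : cancel node_encode node_decode.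
Proof. by elim=> //= [n -> i|n -> i m -> j]. Qed.

HB.instance Definition _ := Countable.copy node (can_type node_encodeK).

Definition pos := (node * bool)%type.

Fixpoint nsize n : nat :=
  match n with
  | Root => 0
  | C n _ => (nsize n).+1
  | D n _ m _ => (nsize n + nsize m).+1
  end.

(* [kanc (n, i) m j] guarantees e_j(E_m) to be in the closure of e_i(E_n). *)
Fixpoint kanc (q : pos) (m : node) (j : bool) : bool :=
  (q == (m, j)) ||
  match m with
  | Root => false
  | C m' i => kanc q m' i
  | D m' _ _ _ => kanc q m' j
  end.

(* A node [D n i m j] for which [kanc (n, i) m j] fails is junk: its positions
   are then treated as mere refinements of those of n. *)
Definition par (q : pos) : option pos :=
  match q.1 with
  | Root => None
  | C n i => Some (n, i)
  | D n i m j =>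
      Some (if (q.2 == i) && kanc (n, i) m j then (m, j) else (n, q.2))
  end.

(** The chain of [par]-ancestors of [(n, k)], listed from the root and ending with [(n, k)]. *)
Fixpoint hist (n : node) (k : bool) : seq pos :=
  rcons match n with
        | Root => [::]
        | C n' i => hist n' i
        | D n' i m j =>
            if (k == i) && kanc (n', i) m j then hist m j else hist n' k
        end (n, k).

Lemma kanc_refl m j : kanc (m, j) m j.
Proof. by case: m => *; rewrite /= eqxx. Qed.

Lemma kancC q m i j : kanc q m i -> kanc q (C m i) j.
Proof. by move=> h /=; rewrite h orbT. Qed.

Lemma kancD q n i m j k : kanc q n k -> kanc q (D n i m j) k.
Proof. by move=> h /=; rewrite h orbT. Qed.

Lemma kanc_trans q n i m j : kanc q n i -> kanc (n, i) m j -> kanc q m j.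
Proof.
move=> qn; elim: m j => [|m ih k|m ih k m' _ k'] j /= /orP[/eqP E|//].
- by case: E qn => -> ->.
- by case: E qn => -> ->.
- by move/ih => ->; rewrite orbT.
- by case: E qn => -> ->.
- by move/ih => ->; rewrite orbT.
Qed.

(** A history leaves the [kanc]-chain only at a D-step that detours through its target. The target
    is itself a [kanc]-descendant of the position left, so by induction the prefix survives. *)
Lemma hist_kanc n i m j : kanc (n, i) m j -> prefix (hist n i) (hist m j).
Proof.
elim: m n i j => [|m ih k|m ih k m' ih' k'] n i j.
- by rewrite /= orbF => /eqP[-> ->] /=; rewrite eqxx.
- move=> /= /orP[/eqP[-> ->]|/ih h]; first by rewrite /= prefix_refl.
  exact/(prefix_trans h)/prefix_rcons.
- move=> /= /orP[/eqP[-> ->]|/ih h]; first by rewrite /= prefix_refl.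
  apply: (prefix_trans _ (prefix_rcons _ _)).
  case: ifP => // /andP[/eqP jk km]; apply: (prefix_trans h).
  by rewrite jk; exact: ih'.
Qed.

Lemma size_hist_gt0 n i : 0 < size (hist n i).
Proof. by case: n => *; rewrite /= ?size_rcons. Qed.

Lemma hist_path n k : exists b p,
  [/\ hist n k = (Root, b) :: p,
      path (fun q q' => par q' == Some q) (Root, b) p &
      last (Root, b) p = (n, k)].
Proof.
elim: n k => [|n ih i|n ih i m ih' j] k; first by exists k, [::].
- have [b [p [h pp lp]]] := ih i; exists b, (rcons p (C n i, k)).
  by rewrite /= h rcons_path last_rcons pp lp /par /= eqxx.
- pose q := if (k == i) && kanc (n, i) m j then (m, j) else (n, k).
  have hq : hist (D n i m j) k = rcons (hist q.1 q.2) (D n i m j, k).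
    by rewrite /q /=; case: ifP.
  have [b [p [h pp lp]]] : exists b p, [/\ hist q.1 q.2 = (Root, b) :: p,
      path (fun q q' => par q' == Some q) (Root, b) p & last (Root, b) p = q].
    by rewrite /q; case: ifP.
  exists b, (rcons p (D n i m j, k)).
  by rewrite hq h rcons_path last_rcons pp lp /par /= eqxx.
Qed.

Lemma par_nsize q q' : par q' = Some q -> nsize q.1 < nsize q'.1.
Proof.
case: q' => -[|n i|n i m j] k //= [<-] //.
by case: ifP => _ /=; rewrite ltnS ?leq_addr ?leq_addl.
Qed.

(* The branch read off from an arbitrary sequence: a term that is not a child of
   the current position is replaced by a default child, so that all sequences,
   and not only branches, are points of the space. *)
Fixpoint lab (x : seqsp pos) l : pos :=
  match l with
  | 0 => (Root, (x 0).2)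
  | l'.+1 =>
      if par (x l) == Some (lab x l') then x l
      else (C (lab x l').1 (lab x l').2, false)
  end.

Lemma par_lab x l : par (lab x l.+1) = Some (lab x l).
Proof. by rewrite /=; case: ifP => [/eqP //|_]; rewrite /par /=; case: lab. Qed.

Lemma nsize_lab x l : l <= nsize (lab x l).1.
Proof.
by elim: l => // l ih; apply: leq_ltn_trans ih (par_nsize (par_lab x l)).
Qed.

Lemma eq_lab k x y l : agree k x y -> l < k -> lab x l = lab y l.
Proof.
move=> xy; elim: l => /= [|l ih] lk; first by rewrite xy.
by rewrite ih ?(ltnW lk) // xy.
Qed.

Definition starts (q : pos) (x : seqsp pos) :=
  forall l, l < size (hist q.1 q.2) -> x l = nth (Root, false) (hist q.1 q.2) l.

Lemma starts_prefix q q' x :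
  prefix (hist q.1 q.2) (hist q'.1 q'.2) -> starts q' x -> starts q x.
Proof.
move=> /prefixP[s e] h l lk; rewrite h ?e ?nth_cat ?lk //.
by rewrite size_cat (leq_trans lk) // leq_addr.
Qed.

Lemma starts_agree q x y :
  starts q x -> starts q y -> agree (size (hist q.1 q.2)) x y.
Proof. by move=> hx hy l lk; rewrite hx ?hy. Qed.

(** A history is a [par]-path from a root position, so [lab] never resorts to its default child
    along it. *)
Lemma starts_lab q x : starts q x -> lab x (size (hist q.1 q.2)).-1 = q.
Proof.
case: q => n k; rewrite /starts /=; have [b [p [-> pp lp]]] := hist_path n k.
move=> hx; rewrite /= -lp (last_nth (Root, false)).
suff : forall l, l <= size p ->
  lab x l = nth (Root, false) ((Root, b) :: p) l by apply.
elim=> [_|l ih lp'] /=; first by rewrite hx.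
rewrite ih ?(ltnW lp') // hx //=.
by have /pathP := pp => /(_ (Root, false) l lp') ->.
Qed.

(** * Limits of growing histories and the edges *)

Definition limseq (q : nat -> pos) : seqsp pos :=
  fun l => nth (Root, false) (hist (q l).1 (q l).2) l.

Section Limseq.
Context (q : nat -> pos).
Let h l := hist (q l).1 (q l).2.
Context (hq : forall l, prefix (h l) (h l.+1)).
Context (sq : forall l, size (h l) < size (h l.+1)).

Lemma size_hist_seq l : l < size (h l).
Proof.
by elim: l => [|l ih]; [exact: size_hist_gt0 | exact: leq_ltn_trans ih (sq l)].
Qed.

Lemma prefix_hist_seq k l : k <= l -> prefix (h k) (h l).
Proof.
elim: l => [|l ih]; first by rewrite leqn0 => /eqP ->; exact: prefix_refl.
rewrite leq_eqVlt => /predU1P[->|/ih kl]; first exact: prefix_refl.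
exact: prefix_trans (hq l).
Qed.

Lemma starts_limseq k : starts (q k) (limseq q).
Proof.
move=> l lk; rewrite /limseq -!/(h _).
have [kl|/ltnW lk'] := leqP k l.
  by have /prefixP[s ->] := prefix_hist_seq kl; rewrite nth_cat lk.
have /prefixP[s ->] := prefix_hist_seq lk'.
by rewrite nth_cat size_hist_seq.
Qed.

End Limseq.

(** Anything but a legal D-step from [t] is replaced by the D-step of [t] towards itself. Hence
    every sequence codes an edge, and [edges] is a continuous image of the whole sequence space. *)
Definition nextD (t t' : node) : node :=
  match t' with
  | D n i m j => if (n == t) && kanc (t, i) m j then t' else D t false t false
  | _ => D t false t false
  end.

Lemma nextDP t t' : exists i m j, nextD t t' = D t i m j /\ kanc (t, i) m j.
Proof.
have h0 : exists i m j, D t false t false = D t i m j /\ kanc (t, i) m j.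
  by exists false, t, false; rewrite kanc_refl.
case: t' => [|n i|n i m j] //=; case: ifP => // /andP[/eqP -> h].
by exists i, m, j.
Qed.

Lemma nextD_id t i m j : kanc (t, i) m j -> nextD t (D t i m j) = D t i m j.
Proof. by rewrite /= eqxx => ->. Qed.

(** On the side being moved, the new history runs through the target, whose history extends the old
    one by [hist_kanc]; the other side just gains the new position. *)
Lemma hist_nextD t t' b :
  prefix (hist t b) (hist (nextD t t') b) /\
  size (hist t b) < size (hist (nextD t t') b).
Proof.
have [i [m [j [-> h]]]] := nextDP t t'; rewrite /= h andbT size_rcons ltnS.
case: eqP => [-> |_].
  have p := hist_kanc h; split; last exact: size_prefix.
  exact/(prefix_trans p)/prefix_rcons.
by split=> //; exact: prefix_rcons.
Qed.

Fixpoint tseq (z : seqsp pos) l : node :=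
  if l is l'.+1 then nextD (tseq z l') (z l).1 else (z 0).1.

Definition endpoint (b : bool) (z : seqsp pos) : seqsp pos :=
  limseq (fun l => (tseq z l, b)).

Lemma endpoint_starts b z l : starts (tseq z l, b) (endpoint b z).
Proof.
by apply: (@starts_limseq (fun l => (tseq z l, b))) => k;
  have [] := hist_nextD (tseq z k) (z k.+1).1 b.
Qed.

Lemma eq_tseq k z z' l : agree k z z' -> l < k -> tseq z l = tseq z' l.
Proof.
move=> zz; elim: l => /= [|l ih] lk; first by rewrite zz.
by rewrite ih ?(ltnW lk) // zz.
Qed.

Lemma endpoint_agree b k z z' :
  agree k z z' -> agree k (endpoint b z) (endpoint b z').
Proof. by move=> zz l lk; rewrite /endpoint /limseq /= (eq_tseq zz). Qed.

Lemma endpoint_continuous b : continuous (endpoint b).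
Proof.
move=> z U /seqsp_nbhsP[k kU]; apply/seqsp_nbhsP; exists k => z' zz.
exact/kU/endpoint_agree.
Qed.

Definition edges : set (seqsp pos * seqsp pos) :=
  range (fun z => (endpoint false z, endpoint true z)).

Lemma edges_analytic : analytic edges.
Proof.
exists (seqsp pos), (fun z => (endpoint false z, endpoint true z)); split => //.
  exact: seqsp_polish (Root, false).
move=> z.
exact: (cvg_pair (@endpoint_continuous false z) (@endpoint_continuous true z)).
Qed.

(** * No countable cover by independent G_delta sets *)

Lemma edges_not_covered (F : nat -> nat -> set (seqsp pos)) :
  (forall k m, closed (F k m)) -> (forall x, exists k, forall m, ~ F k m x) ->
  exists x y k, edges (x, y) /\ forall m, ~ F k m x /\ ~ F k m y.
Proof.
move=> cF hF; apply: contrapT => indep.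
pose anc (q q' : pos) := kanc q q'.1 q'.2.
pose hsize (q : pos) := size (hist q.1 q.2).
pose avoid q (B : set (seqsp pos)) :=
  exists2 q', anc q q' & forall x, starts q' x -> ~ B x.
(* Failure of [avoid] means that the neighbourhood of every position below [q'] meets [F k m]. *)
have claim (q : pos) k : exists q',
    [/\ anc q q', hsize q < hsize q' & exists m, ~ avoid q' (F k m)].
  apply: contrapT => nq.
  have {}nq q' m : anc q q' -> hsize q < hsize q' -> avoid q' (F k m).
    move=> a s; apply: contrapT => nav; apply: nq.
    by exists q'; split => //; exists m.
  (* Both positions of this child are below [q], so both endpoints of the edge stay where [nq]
     applies. *)
  pose n0 := C q.1 q.2.
  (* t is kept below n0 by D-steps, which preserve the bit of a position; at
     stage l the endpoint of bit [odd l] is steered out of F k l./2. *)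
  have [|l t It|t [t0 ht]] := @sequential_choice node
    (fun t => forall b, kanc (n0, b) t b)
    (fun l t t' => exists m j, [/\ t' = D t (odd l) m j, kanc (t, odd l) m j &
       forall x, starts (m, j) x -> ~ F k l./2 x]) n0.
  - by move=> b; exact: kanc_refl.
  - have qt : kanc q t (odd l).
      apply: kanc_trans (It (odd l)).
      by apply: kancC; case: (q) => ? ?; exact: kanc_refl.
    have [||[m j] tm mF] := nq (C t (odd l), false) l./2.
    + exact: kancC.
    + rewrite /hsize /= size_rcons.
      have := size_prefix (hist_kanc (It (odd l))).
      by rewrite /n0 /= size_rcons => /leqW.
    exists (D t (odd l) m j); split.
      by move=> b; exact/kancD/It.
    exists m, j; split => //.
    exact/(kanc_trans _ tm)/kancC/kanc_refl.
  pose z : seqsp pos := fun l => (t l, false).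
  have tz l : tseq z l = t l.
    elim: l => //= l ->; have [_ [m [j [-> h _]]]] := ht l.
    exact: nextD_id.
  apply: indep; exists (endpoint false z), (endpoint true z), k.
  split; first by exists z.
  suff av b m : ~ F k m (endpoint b z) by [].
  (* Stage b + 2m has parity b and half m: it steers the endpoint of bit [b] out of [F k m]. *)
  have [_ [m' [j [tD h]]]] := ht (b + m.*2).
  rewrite half_bit_double oddD odd_double addbF oddb in tD h * => nF.
  apply: nF; have := @endpoint_starts b z (b + m.*2).+1; apply: starts_prefix.
  by rewrite tz tD /= eqxx h prefix_rcons.
have [|k q _|Q [Q0 hQ]] := @sequential_choice pos (fun=> True)
  (fun k q q' => [/\ anc q q', hsize q < hsize q' &
     exists m, ~ avoid q' (F k m)]) (Root, false).
- exact: I.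
- by have [q' h] := claim q k; exists q'; split; [exact: I | exact: h].
have anc_trans q q' q'' : anc q q' -> anc q' q'' -> anc q q''.
  by case: q' => n i; exact: kanc_trans.
have ancS l : anc (Q l) (Q l.+1) by have [_ []] := hQ l.
have ancQ k l : k <= l -> anc (Q k) (Q l).
  move=> /subnK <-; elim: (l - k) => [|i ih]; last exact: anc_trans (ancS _).
  by rewrite add0n; case: (Q k) => n i; exact: kanc_refl.
have pQ l : prefix (hist (Q l).1 (Q l).2) (hist (Q l.+1).1 (Q l.+1).2).
  by apply: hist_kanc; have := ancS l; rewrite /anc; case: (Q l).
have sQ l : hsize (Q l) < hsize (Q l.+1) by have [_ []] := hQ l.
have [k hk] := hF (limseq Q).
(* This [F k m] meets the neighbourhood of every position below [Q k.+1]. The neighbourhoods of the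
   later [Q l] shrink to the limit, so a closed set missing the limit would be avoided. *)
have [_ [_ _ [m]]] := hQ k; apply.
have [K hK] : exists K, agree K (limseq Q) `<=` ~` F k m.
  apply/seqsp_nbhsP; apply: open_nbhs_nbhs; split; last exact: hk.
  exact: closed_openC.
exists (Q (maxn K k.+1)); first by apply: ancQ; rewrite leq_maxr.
move=> y hy; apply: hK.
have := starts_agree (@starts_limseq Q pQ sQ (maxn K k.+1)) hy; apply: agree_le.
exact: leq_trans (leq_maxl _ _) (ltnW (size_hist_seq sQ _)).
Qed.

(** * Countable bases and geometric convergence *)

Lemma separable_basis {T : topologicalType} (d : T -> T -> R) :
  is_metric d -> metric_compatible d -> separable_space (T := T) ->
  exists B : nat * nat -> set T, (forall k, open (B k)) /\
    forall O x, open O -> O x -> exists2 k, B k x & B k `<=` O.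
Proof.
move=> md cd [S [/countable_injP[f finj] dS]].
exists (fun k => [set y | exists2 x, S x /\ f x = k.1 & (d x y < eps k.2)%R]).
split=> [k|O x oO Ox].
  rewrite (_ : mkset _ = \bigcup_(x in [set x | S x /\ f x = k.1])
                           [set y | (d x y < eps k.2)%R]) //.
  by apply: bigcup_open => x _; exact: open_dist.
have [n nO] := (nbhs_distP md cd x O).1 (open_nbhs_nbhs (conj oO Ox)).
have : closure S x by rewrite dS.
move=> /(closure_distP md cd) /(_ n.+1)[y Sy xy].
exists (f y, n.+1); first by exists y => //; rewrite (dist_sym md).
move=> z /= [y' [Sy' fy'] yz]; apply: nO => /=.
have E : y' = y by apply: finj; rewrite ?inE.
rewrite E in yz; rewrite epsS.
by have := dist_triangle md y x z; lra.
Qed.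

Section GeometricSeries.
Local Open Scope ring_scope.
Context {T : topologicalType} {d : T -> T -> R} {v : nat -> T}.
Context (md : is_metric d) (cd : metric_compatible d) (mc : metric_complete d).
Context (vS : forall k, d (v k) (v k.+1) <= eps k).

Lemma geometric_dist k l : (k <= l)%N -> d (v k) (v l) <= eps k + eps k.
Proof.
move=> /subnK <-; set i := (l - k)%N.
(* Subtracting the tail of the geometric series makes the induction go through. *)
suff : d (v k) (v (i + k)%N) <= eps k + eps k - (eps (i + k) + eps (i + k)).
  by have := eps_gt0 (i + k); lra.
elim: i => [|i ih]; first by rewrite add0n (dist_xx md); lra.
have := dist_triangle md (v (i + k)%N) (v k) (v (i.+1 + k)%N).
have := vS (i + k); have := epsS (i + k); rewrite -addSn; lra.
Qed.

Lemma geometric_cvg :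
  exists x, v @ \oo --> x /\ forall k, d (v k) x <= eps k + eps k.
Proof.
have [|x vx] := mc (u := v).
  move=> e /eps_lt[n ne]; exists n.+2 => i j ni nj.
  have := geometric_dist ni; have := geometric_dist nj.
  have := dist_triangle md (v n.+2) (v i) (v j).
  rewrite (dist_sym md (v i) (v n.+2)).
  by have := epsS n; have := epsS n.+1; lra.
exists x; split => // k; rewrite leNgt; apply/negP => xk.
have [|n ne] := @eps_lt (d (v k) x - (eps k + eps k)); first lra.
have /(cvg_distP md cd) /(_ n)[N hN] := vx.
have := hN (maxn N k) (leq_maxl _ _).
have := geometric_dist (leq_maxr N k).
have := dist_triangle md (v (maxn N k)) (v k) x.
by rewrite (dist_sym md (v (maxn N k)) x); lra.
Qed.

End GeometricSeries.

(** * Homomorphisms from the minimal relation *)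

Section Scheme.
Context {X P : topologicalType} (d : X -> X -> R) (dP : P -> P -> R).
Context (md : is_metric d) (cd : metric_compatible d) (mcX : metric_complete d).
Context (mP : is_metric dP) (cP : metric_compatible dP).
Context (mcP : metric_complete dP).
Context (sepP : separable_space (T := P)).
Context (e : bool -> P -> X) (ce : forall i, continuous (e i)).
Implicit Types (V : set X) (E O Q : set P).

(* The covering G_delta sets are the complements of the unions of [H k]. *)
Definition Gdelta_cover V (H : nat -> nat -> set X) :=
  [/\ forall k m, closed (H k m),
      forall k p, exists m i, H k m (e i p) &
      forall x, V x -> exists k, forall m, ~ H k m x].

Definition small V := exists H, Gdelta_cover V H.

Lemma small_subset V V' : V `<=` V' -> small V' -> small V.
Proof. by move=> VV [H [h1 h2 h3]]; exists H; split => // x /VV /h3. Qed.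

Lemma small_set0 : small set0.
Proof.
exists (fun _ _ => setT); split=> [_ _|k p|//]; first exact: closedT.
by exists 0, false.
Qed.

Lemma small_bigcup (I : countType) (V : I -> set X) :
  (forall i, small (V i)) -> small (\bigcup_i V i).
Proof.
move=> /choice[H hH].
exists (fun l => if unpickle l is Some ik then H (ik : I * nat).1 ik.2
                 else fun=> setT); split=> [l m|l p|x [i _ Vx]].
- by case: unpickle => [[i k]|]; [case: (hH i) | exact: closedT].
- case: unpickle => [[i k]|]; first by case: (hH i) => _ + _; apply.
  by exists 0, false.
- have [_ _ /(_ x Vx)[k hk]] := hH i.
  by exists (pickle (i, k)) => m; rewrite pickleK; exact: hk.
Qed.

Lemma small_setU V V' : small V -> small V' -> small (V `|` V').
Proof.
move=> sV sV'; apply: small_subset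
  (small_bigcup (V := fun b : bool => if b then V else V') _).
  by move=> x [Vx|V'x]; [exists true | exists false].
by case.
Qed.

(** The edges in [Q] can be destroyed by closed sets at the cost of only a small part of [V]. *)
Definition negligible V Q := exists F : nat -> set X,
  [/\ forall n, closed (F n), forall n, small (V `&` F n) &
      forall p, Q p -> exists n i, F n (e i p)].

Lemma negligible_subset V Q Q' : Q `<=` Q' -> negligible V Q' -> negligible V Q.
Proof. by move=> QQ [F [h1 h2 h3]]; exists F; split => // p /QQ /h3. Qed.

Lemma negligible_bigcup V (I : countType) (Q : I -> set P) :
  (forall i, negligible V (Q i)) -> negligible V (\bigcup_i Q i).
Proof.
move=> /choice[F hF].
exists (fun l =>
  if unpickle l is Some ik then F (ik : I * nat).1 ik.2 else set0).
split=> [l|l|p [i _ Qp]].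
- by case: unpickle => [[i k]|]; [case: (hF i) | exact: closed0].
- case: unpickle => [[i k]|]; first by case: (hF i).
  by rewrite setI0; exact: small_set0.
- have [_ _ /(_ p Qp)[k [b hk]]] := hF i.
  by exists (pickle (i, k)), b; rewrite pickleK.
Qed.

Lemma negligible_setU V Q Q' :
  negligible V Q -> negligible V Q' -> negligible V (Q `|` Q').
Proof.
move=> sV sV'; apply: negligible_subset
  (negligible_bigcup (Q := fun b : bool => if b then Q else Q') _).
  by move=> x [Vx|V'x]; [exists true | exists false].
by case.
Qed.

Lemma negligible_setT V : negligible V setT -> small V.
Proof.
move=> [F [cF sF hF]].
apply: small_subset (small_setU (V := V `\` \bigcup_n F n) _ (small_bigcup sF)).
  move=> x Vx; have [[n _ Fx]|nF] := pselect ((\bigcup_n F n) x).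
    by right; exists n.
  by left.
exists (fun=> F); split => // [k p|x [_ nF]]; first exact: hF.
by exists 0 => m Fx; apply: nF; exists m.
Qed.

Definition good V E := forall i O, open O -> O `&` E !=set0 ->
  ~ small (V `&` closure (e i @` (O `&` E))).

(** A Cantor-Bendixson argument: [E] is what remains of [P] after all negligible basic open sets are
    removed. It is nonempty, since otherwise [P] would be negligible and [V] small. *)
Lemma good_exists V : ~ small V -> exists E p, good V E /\ E p.
Proof.
move=> nV; have [B [oB hB]] := separable_basis mP cP sepP.
pose N := \bigcup_(k in [set k | negligible V (B k)]) B k.
have negN : negligible V N.
  apply: (@negligible_subset _ _
    (\bigcup_k (if pselect (negligible V (B k)) then B k else set0))).
    by move=> p [k nk Bp]; exists k => //; case: pselect.
  apply: negligible_bigcup => k; case: pselect => [//|nk].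
  by exists (fun=> set0); split => // [_|_]; rewrite ?setI0;
    [exact: closed0 | exact: small_set0].
have [p Np] : exists p, ~ N p.
  apply/not_existsP => hN; apply/nV/negligible_setT/(negligible_subset _ negN).
  by move=> p _; exact: contrapT (hN p).
exists (~` N), p; split => // i O oO [q [Oq Nq]] sm; apply: Nq.
have [k Bq BO] := hB O q oO Oq; exists k => //=.
(* The part of [O] outside [N] is negligible through the single closed set [closure (e i @] (O [&]
   ~[N))], so [B k] is negligible and should have been removed. *)
apply: negligible_subset (negligible_setU negN (Q' := O `&` ~` N) _).
  by move=> r /BO Or; have [|] := pselect (N r); [left | right].
exists (fun=> closure (e i @` (O `&` ~` N))); split => // [_|r hr].
  exact: closed_closure.
by exists 0, i; apply: subset_closure; exists r.
Qed.

Lemma good_setI V E O : open O -> good V E -> good V (E `&` O).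
Proof.
move=> oO gE i O' oO'; rewrite (setIC E) setIA => ne.
by apply: gE ne; exact: openI.
Qed.

(** The empty set is small, so [V] meets the closure of the image of every neighbourhood of [p] in
    [E]. *)
Lemma good_closure V E i p : good V E -> E p -> closure V (e i p).
Proof.
move=> gE Ep; apply/(closure_distP md cd) => n.
pose O := e i @^-1` [set y | (d (e i p) y < eps n.+1)%R].
have oO : open O by have /continuousP := @ce i; apply; exact: open_dist.
have Op : O p by rewrite /O /= (dist_xx md) eps_gt0.
have [x [Vx cx]] : V `&` closure (e i @` (O `&` E)) !=set0.
  apply/set0P/eqP => V0; apply: (gE i O oO); first by exists p.
  by rewrite V0; exact: small_set0.
exists x => //; apply: le_lt_trans (_ : (eps n.+1 < eps n)%R); last first.
  by have := epsS n; have := eps_gt0 n.+1; lra.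
apply: (closure_dist_le md cd) cx => _ [q [Oq _] <-]; exact: ltW.
Qed.

Definition tiny k E := forall p q, E p -> E q ->
  (dP p q <= eps k)%R /\ forall i, (d (e i p) (e i q) <= eps k)%R.

Lemma tiny_nbhd k p : exists O, [/\ open O, O p & tiny k O].
Proof.
pose B i := e i @^-1` [set y | (d (e i p) y < eps k.+1)%R].
have oB i : open (B i) by have /continuousP := @ce i; apply; exact: open_dist.
exists ([set q | (dP p q < eps k.+1)%R] `&` (B false `&` B true)); split.
- by apply: openI; [exact: open_dist | exact: openI].
- by rewrite /B /= !(dist_xx mP) !(dist_xx md); do !split; exact: eps_gt0.
- move=> q r [/= pq [Bq Bq']] [/= pr [Br Br']]; rewrite epsS; split.
    by have := dist_triangle mP p q r; rewrite (dist_sym mP q p); lra.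
  move=> i; have {Bq Bq'} : B i q by case: i.
  have {Br Br'} : B i r by case: i.
  rewrite /B /=; have := dist_triangle md (e i p) (e i q) (e i r).
  by rewrite (dist_sym md (e i q) (e i p)); lra.
Qed.

(** * Construction of the sets and points attached to the nodes *)

Definition state := (set X * set P * P)%type.
Implicit Type s : state.

Definition proper k s := [/\ good s.1.1 s.1.2, s.1.2 s.2 & tiny k s.1.2].

(** Serves the root and the C-nodes. To make the choice total, small sets receive a dummy state. *)
Lemma proper_start : ~ small setT -> exists f : set X * nat -> state,
  forall V k, ~ small V -> (f (V, k)).1.1 = V /\ proper k (f (V, k)).
Proof.
move=> nT; have [_ [p0 _]] := good_exists nT.
suff /choice[f hf] : forall Vk : set X * nat, exists s : state,
    ~ small Vk.1 -> s.1.1 = Vk.1 /\ proper Vk.2 s.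
  by exists f => V k; exact: hf (V, k).
move=> [V k]; have [sV|/good_exists[E [p [gE Ep]]]] := pselect (small V).
  by exists (set0, set0, p0).
have [W [oO Op tO]] := tiny_nbhd k p.
exists (V, E `&` W, p) => _; split => //; split => /=; first exact: good_setI.
  by split.
by move=> q r [_ Oq] [_ Or]; exact: tO.
Qed.

(** Serves the D-nodes: the edge set is cut down to a tiny neighbourhood of an edge whose i-th
    endpoint is near [x], if [x] is in the closure. *)
Lemma proper_refine : exists f : state * X * bool * nat -> state,
  forall s x i k l, proper l s -> let s' := f (s, x, i, k) in
    [/\ s'.1.1 = s.1.1, s'.1.2 `<=` s.1.2, proper k s' &
     closure (e i @` s.1.2) x -> (d x (e i s'.2) <= eps k)%R].
Proof.
suff /choice[f hf] : forall t : state * X * bool * nat, exists s' : state,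
    forall l, proper l t.1.1.1 ->
    [/\ s'.1.1 = t.1.1.1.1.1, s'.1.2 `<=` t.1.1.1.1.2, proper t.2 s' &
     closure (e t.1.2 @` t.1.1.1.1.2) t.1.1.2 ->
     (d t.1.1.2 (e t.1.2 s'.2) <= eps t.2)%R].
  by exists f => s x i k l; exact: hf (s, x, i, k) l.
move=> [[[[[V E] p] x] i] k] /=.
have [nE|/existsNP[l0 /contrapT[/= gE Ep tE]]] :=
  pselect (forall l, ~ proper l (V, E, p)); first by exists (V, E, p) => l /nE.
have [q [Eq xq]] : exists q, E q /\
    (closure (e i @` E) x -> (d x (e i q) <= eps k)%R).
  have [cx|nx] := pselect (closure (e i @` E) x); last by exists p.
  have [_ [q Eq <-] xq] := (closure_distP md cd _ _).1 cx k.
  by exists q; split => // _; exact: ltW.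
have [W [oO Oq tO]] := tiny_nbhd k q.
exists (V, E `&` W, q) => l _; split => //=.
split => /=; [exact: good_setI | by split |].
by move=> r r' [_ Or] [_ Or']; exact: tO.
Qed.

Lemma scheme : ~ small setT ->
  exists (V : node -> set X) (E : node -> set P) (p : node -> P),
  [/\ forall n, [/\ good (V n) (E n), E n (p n) & tiny (nsize n) (E n)],
      forall n i, V (C n i) = V n `&` closure (e i @` E n),
      forall n i m j, E (D n i m j) `<=` E n &
      forall n i m j, closure (e i @` E n) (e j (p m)) ->
        (d (e j (p m)) (e i (p (D n i m j))) <= eps (nsize (D n i m j)))%R].
Proof.
move=> nT; have [start hstart] := proper_start nT.
have [refine hrefine] := proper_refine.
pose F := fix F n : state := match n with
  | Root => start (setT, 0)
  | C n' i => start ((F n').1.1 `&` closure (e i @` (F n').1.2), nsize n)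
  | D n' i m j => refine (F n', e j (F m).2, i, nsize n)
  end.
have bigV n i : proper (nsize n) (F n) ->
    ~ small ((F n).1.1 `&` closure (e i @` (F n).1.2)).
  move=> [g Fp _]; have := g i setT openT; rewrite setTI; apply.
  by exists (F n).2.
have pF n : proper (nsize n) (F n).
  elim: n => [|n ih i|n ih i m _ j].
  - exact: (hstart _ _ nT).2.
  - exact: (hstart _ _ (bigV n i ih)).2.
  - by have [] := hrefine _ (e j (F m).2) i (nsize (D n i m j)) _ ih.
exists (fun n => (F n).1.1), (fun n => (F n).1.2), (fun n => (F n).2).
split=> [n|n i|n i m j|n i m j].
- exact: pF.
- exact: (hstart _ _ (bigV n i (pF n))).1.
- by have [] := hrefine _ (e j (F m).2) i (nsize (D n i m j)) _ (pF n).
- by have [] := hrefine _ (e j (F m).2) i (nsize (D n i m j)) _ (pF n).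
Qed.

Lemma homomorphism_of_not_small : ~ small setT ->
  exists f : seqsp pos -> X, continuous f /\
    forall x y, edges (x, y) -> exists p, f x = e false p /\ f y = e true p.
Proof.
move=> /scheme[V [E [p [hE VC ED pD]]]].
pose u (q : pos) := e q.2 (p q.1).
have E_V n i q : E n q -> closure (V n) (e i q).
  by have [gE _ _] := hE n; exact: good_closure.
have closure_sub n i B : B `<=` closure (e i @` E n) ->
    closure B `<=` closure (e i @` E n).
  move=> /closure_subset.
  by rewrite -((closure_id (closure (e i @` E n))).1 (@closed_closure _ _)).
have kancE n i m j q : kanc (n, i) m j -> E m q -> closure (e i @` E n) (e j q).
  elim: m j q => [|m ih k|m ih k m' _ k'] j q /= /orP[/eqP[-> ->]|//]
    => [Eq|Eq|h Eq|Eq|h /ED Eq].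
  - by apply: subset_closure; exists q.
  - by apply: subset_closure; exists q.
  - have := E_V _ j _ Eq; apply: (closure_sub); rewrite VC => x [_].
    by apply: closure_sub => _ [r Er <-]; exact: ih.
  - by apply: subset_closure; exists q.
  - exact: ih.
have u_kanc n i m j : kanc (n, i) m j ->
    (d (u (n, i)) (u (m, j)) <= eps (nsize n))%R.
  have [_ Epn tn] := hE n; have [_ Epm _] := hE m.
  move=> /kancE /(_ Epm); apply: (closure_dist_le md cd) => _ [r Er <-].
  by have [_] := tn _ _ Epn Er; apply.
have u_par q q' : par q' = Some q -> (d (u q) (u q') <= eps (nsize q.1))%R.
  case: q' => -[|n i|n i m j] k //= [<-] /=.
    exact/u_kanc/kancC/kanc_refl.
  case: ifP => [/andP[/eqP-> h]|_]; last exact/u_kanc/kancD/kanc_refl.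
  have [_ Epm _] := hE m.
  apply: le_trans (pD _ _ _ _ (kancE _ _ _ _ _ h Epm)) _.
  by apply: eps_le; rewrite /= leqW // leq_addl.
have /choice[f hf] x :
    exists y, forall k, (d (u (lab x k)) y <= eps k + eps k)%R.
  have [|y [_ hy]] := @geometric_cvg _ _ (fun k => u (lab x k)) md cd mcX.
    move=> k; apply: le_trans (u_par _ _ (par_lab x k)) _.
    exact/eps_le/nsize_lab.
  by exists y.
exists f; split=> [x U /(nbhs_distP md cd)[n nU]|x y [z _ [<- <-]]].
  (* Agreement below [n.+4] gives a common label at [n.+3], from which both values are within 2
     [eps n.+3]. *)
  apply/seqsp_nbhsP; exists n.+4 => y xy; apply: nU => /=.
  have := hf x n.+3; have := hf y n.+3; rewrite (eq_lab xy) //.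
  have := dist_triangle md (u (lab y n.+3)) (f x) (f y).
  rewrite (dist_sym md (f x) (u _)).
  have := epsS n; have := epsS n.+1; have := epsS n.+2; have := eps_gt0 n.+3.
  lra.
pose t := tseq z.
have tS l : E (t l.+1) `<=` E (t l).
  by rewrite /t /=; have [i [m [j [-> _]]]] := nextDP (tseq z l) (z l.+1).1.
have t_size l : l <= nsize (t l).
  elim: l => // l ih; rewrite /t /=.
  have [i [m [j [-> _]]]] := nextDP (tseq z l) (z l.+1).1.
  by rewrite ltnS (leq_trans ih) // leq_addr.
have pt l : (dP (p (t l)) (p (t l.+1)) <= eps l)%R.
  have [_ Ep tl] := hE (t l); have [_ EpS _] := hE (t l.+1).
  have [h _] := tl _ _ Ep (tS l _ EpS); apply: le_trans h _.
  exact: eps_le.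
(* The edges attached to the nodes [t l] converge in [P]. As [(t l, b)] lies on the branch
   [endpoint b z], its image under [f] is the corresponding endpoint of the limit edge [r]. *)
have [r [pr _]] := @geometric_cvg _ _ (fun l => p (t l)) mP cP mcP pt.
suff fe b : f (endpoint b z) = e b r by exists r.
apply: (dist_small md) => n.
have /(cvg_distP md cd) /(_ n.+1)[N hN] :
    e b \o (fun l => p (t l)) @ \oo --> e b r.
  by apply: continuous_cvg pr; exact: ce.
pose l := maxn N n.+2.
have hl := size_hist_seq (q := fun l => (t l, b))
  (fun l => (hist_nextD (tseq z l) (z l.+1).1 b).2) l.
have := hf (endpoint b z) (size (hist (t l) b)).-1.
rewrite (starts_lab (@endpoint_starts b z l)) /=.
set k := _.-1 => hk.
have kn : (eps k <= eps n.+2)%R.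
  apply: eps_le; rewrite -ltnS prednK; last exact: leq_ltn_trans hl.
  by apply: leq_ltn_trans hl; exact: leq_maxr.
have := hN l (leq_maxl _ _) => /=; rewrite -/(u (t l, b)).
have := dist_triangle md (u (t l, b)) (f (endpoint b z)) (e b r).
rewrite (dist_sym md (f _) (u _)) (dist_sym md (e b r)).
by have := epsS n; have := epsS n.+1; lra.
Qed.

End Scheme.

(** * Colorings and the dichotomy *)

Lemma coloring_of_small {X P : topologicalType} (d : X -> X -> R)
    (e : bool -> P -> X) :
  is_metric d -> metric_compatible d -> small e setT ->
  exists c : X -> nat, (forall n, Delta0 3 (c @^-1` [set n])) /\
    forall p, c (e false p) <> c (e true p).
Proof.
move=> md cd [H [cH eH hH]].
(* The color is the index of the first G_delta set containing the point; taking the least index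
   makes each color class a difference of simple sets. *)
have /choice[c hc] x : exists n, (forall m, ~ H n m x) /\
    forall k, k < n -> exists m, H k m x.
  have [n0 hn0] := hH x I.
  have ex : exists n, `[< forall m, ~ H n m x >] by exists n0; apply/asboolP.
  case: (ex_minnP ex) => n /asboolP hn min; exists n; split => // k kn.
  apply: contrapT => /forallNP nk; move: kn; rewrite ltnNge min //.
  exact/asboolP.
exists c; split; last first.
  move=> p cp; have [m [[]]] := eH (c (e false p)) p => [|].
    by rewrite cp; apply: (hc _).1.
  by apply: (hc _).1.
pose K n := \bigcup_m H n m.
have SK n : Sigma0_ 1 (K n).
  apply: Sigma0_bigcup => m; rewrite -[H n m]setCK; apply: Sigma0_setC.
  exact: closed_openC.
pose L n := [set x | forall k, k < n -> K k x].
have SL n : Sigma0_ 1 (L n).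
  elim: n => [|n ih].
    rewrite (_ : L 0 = setT); first exact: (Sigma0_setT_set0 1).1.
    by apply/seteqP; split.
  rewrite (_ : L n.+1 = L n `&` K n); first exact: Sigma0_setI.
  apply/seteqP; split=> [x Lx|x [Lx Kx] k].
    by split; [move=> k kn; apply/Lx/ltnW | apply: Lx].
  by rewrite ltnS leq_eqVlt => /predU1P[->|/Lx].
(* A G_delta set intersected with an F_sigma set, hence of class Delta^0_3. *)
move=> n; have -> : c @^-1` [set n] = ~` K n `&` L n.
  apply/seteqP; split=> [x /= <-|x [nK Lx]] /=.
    split; first by move=> [m _]; exact: (hc x).1.
    by move=> k /(hc x).2[m Hm]; exists m.
  have [cn|nc|//] := ltngtP (c x) n.
    by have [m _ /(hc x).1] := Lx _ cn.
  by have [m Hm] := (hc x).2 n nc; case: nK; exists m.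
split; first apply: (@Sigma0_setI _ 2).
- exact: Sigma0_setC.
- exact: (Sigma0_S md cd).
- rewrite /Pi0 setCI setCK; apply: (@Sigma0_setU _ 2).
    exact: (Sigma0_S md cd).
  exact: Sigma0_setC.
Qed.

(** Each color class splits into countably many G_delta sets; all of these together cover the space,
    so one of them contains both endpoints of an edge. *)
Lemma edges_monochromatic (c : seqsp pos -> nat) :
  (forall n, Sigma0 3 (c @^-1` [set n])) ->
  exists x y, edges (x, y) /\ c x = c y.
Proof.
move=> /choice[G hG].
have /choice[F hF] (ni : nat * nat) : exists F : nat -> set (seqsp pos),
    (forall m, closed (F m)) /\ ~` G ni.1 ni.2 = \bigcup_m F m.
  have [F [cF eF]] := (hG ni.1).1 ni.2; exists F; split => // m.
  by rewrite -openC; exact: cF.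
have GF ni x : G ni.1 ni.2 x <-> forall m, ~ F ni m x.
  rewrite -[G _ _]setCK (hF ni).2; split=> [nF m Fx|nF [m _ Fx]].
    by apply: nF; exists m.
  exact: nF Fx.
have [k m|x|x [y [k [xy hk]]]] := @edges_not_covered
  (fun k => if unpickle k is Some ni then F ni else fun=> setT).
- by case: unpickle => [ni|]; [exact: (hF ni).1 | exact: closedT].
- have : (c @^-1` [set (c x)]) x by [].
  rewrite (hG (c x)).2 => -[i _ Gx].
  by exists (pickle (c x, i)); rewrite pickleK; apply/GF.
move: hk; case: (unpickle k) => [ni hk|/(_ 0)[/(_ I)]//].
have cG z : G ni.1 ni.2 z -> c z = ni.1.
  by move=> Gz; have : (c @^-1` [set ni.1]) z by rewrite (hG _).2; exists ni.2.
by exists x, y; rewrite !cG //; apply/GF => m; case: (hk m).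
Qed.

Theorem theorem5p1 :
  exists (X3 : topologicalType) (A3 : set (X3 * X3)),
    [/\ polish X3, zero_dim X3, analytic A3 &
      forall (X : topologicalType) (A : set (X * X)),
        polish X -> analytic A ->
        let a := exists c : X -> nat,
                   (forall n : nat, Delta0 3 (c @^-1` [set n])) /\
                   (forall x y : X, A (x, y) -> c x <> c y) in
        let b := exists f : X3 -> X,
                   continuous f /\
                   (forall alpha beta : X3, A3 (alpha, beta) -> A (f alpha, f beta)) in
        (a \/ b) /\ ~ (a /\ b)].
Proof.
exists (seqsp pos), edges; split.
- exact: seqsp_polish (Root, false).
- exact: seqsp_zero_dim.
- exact: edges_analytic.
move=> X A [_ [d [md cd mcX]]] [P [g [[sepP [dP [mP cP mcP]]] cg <-]]] /=; split.
  pose e (i : bool) (p : P) := if i then (g p).2 else (g p).1.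
  have ce i : continuous (e i).
    move=> p; rewrite /e; case: i.
      by apply: (cvg_comp g snd (cg p)); exact: cvg_snd.
    by apply: (cvg_comp g fst (cg p)); exact: cvg_fst.
  have [sm|nsm] := pselect (small e setT).
    left; have [c [hc ec]] := coloring_of_small md cd sm; exists c; split => //.
    by move=> x y [p _ gp]; have := ec p; rewrite /e gp.
  right; have [f [cf ef]] :=
    homomorphism_of_not_small md cd mcX mP cP mcP sepP ce nsm.
  exists f; split => // x y /ef[p [-> ->]]; exists p => //.
  by rewrite /e; case: (g p).
move=> [[c [hc ec]] [f [cf ef]]].
(* If both alternatives held, the coloring pulled back along [f] would have a monochromatic edge. *)
have [n|x [y [xy cxy]]] := @edges_monochromatic (c \o f).
  by rewrite comp_preimage; apply: Sigma0_preimage cf _; exact: (hc n).1.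
exact: ec (ef _ _ xy) cxy.
Qed.
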